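(* Let $Z$ be an antipodal space and let $\rho_1\in\mathcal{M}(Z)$. Given $\tau_0\in C(Z)$, let $t\in[0,\infty)\mapsto\tau_t\in C(Z)$ denote the unique solution of the $\rho_1$-antipodal flow $\frac{d}{dt}\tau_t=-D_{\rho_1}(\tau_t)$ starting from $\tau_0$. Then the limit $\tau_\infty:=\lim_{t\to\infty}\tau_t$ exists in $C(Z)$, and $$\|\tau_t-\tau_\infty\|_\infty\le4\,\|D_{\rho_1}(\tau_0)\|_\infty\,e^{-t/2}\quad\text{for all }t\ge0.$$ Also $D_{\rho_1}(\tau_\infty)\equiv0$. Thus if $\rho:=E_{\rho_1}(\tau_\infty)$, then $\rho$ is an antipodal function Moebius equivalent to $\rho_1$, so $\rho\in\mathcal{M}(Z)$, and $\log\frac{d\rho}{d\rho_1}=\tau_\infty$.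
   Context: Antipodal spaces and Moebius spaces. Let $Z$ be a compact metrizable space containing at least four points. A separating function on $Z$ is a continuous function $\rho : Z\times Z\to[0,\infty)$ which is symmetric and satisfies $\rho(\xi,\eta)=0$ if and only if $\xi=\eta$. Its cross-ratio is defined on quadruples of distinct points of $Z$ by $[\xi,\xi',\eta,\eta']_\rho=\frac{\rho(\xi,\eta)\rho(\xi',\eta')}{\rho(\xi,\eta')\rho(\xi',\eta)}$. Two separating functions are Moebius equivalent if their cross-ratios agree. If $\rho_1,\rho_2$ are Moebius equivalent, there is a unique positive continuous function $\frac{d\rho_2}{d\rho_1}:Z\to(0,\infty)$, the derivative, such that $\rho_2(\xi,\eta)^2=\frac{d\rho_2}{d\rho_1}(\xi)\frac{d\rho_2}{d\rho_1}(\eta)\rho_1(\xi,\eta)^2$ for all $\xi,\eta\in Z$. An antipodal function on $Z$ is a separating function $\rho$ such that $\sup_{\xi,\eta}\rho(\xi,\eta)=1$ and for every $\xi\in Z$ there is $\eta\in Z$ with $\rho(\xi,\eta)=1$. An antipodal space $(Z,\rho_0)$ is such a space $Z$ equipped with an antipodal function $\rho_0$. Its Moebius space $\mathcal{M}(Z)=\mathcal{M}(Z,\rho_0)$ is the set of all antipodal functions on $Z$ Moebius equivalent to $\rho_0$. $C(Z)$ is the Banach space of real continuous functions on $Z$ with the sup norm. For $\tau\in C(Z)$, $E_{\rho_1}(\tau)$ is the separating function $E_{\rho_1}(\tau)(\xi,\eta)=e^{\frac12\tau(\xi)}e^{\frac12\tau(\eta)}\rho_1(\xi,\eta)$. The discrepancy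 function $D_{\rho_1}(\tau)\in C(Z)$ is $D_{\rho_1}(\tau)(\xi)=\max_{\eta\in Z\setminus\{\xi\}}\big(\tau(\xi)+\tau(\eta)+\log\rho_1(\xi,\eta)^2\big)$. The $\rho_1$-antipodal flow is the ODE $\frac{d}{dt}\tau_t=-D_{\rho_1}(\tau_t)$ in $C(Z)$; a solution is a $C^1$ curve in $C(Z)$ satisfying it. For every $\tau_0\in C(Z)$ there is a unique solution starting from $\tau_0$ defined for all $t\ge0$. *)

(* Defs.v *)
From HB Require Import structures.
From mathcomp Require Import all_boot all_order all_algebra.
From mathcomp Require Import all_classical all_reals all_analysis.

Set Implicit Arguments.
Unset Strict Implicit.
Unset Printing Implicit Defensive.

Import Order.TTheory GRing.Theory Num.Theory.
Import numFieldNormedType.Exports.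

Local Open Scope classical_set_scope.
Local Open Scope ring_scope.

Section AntipodalSpaces.
Variables (R : realType) (Z : topologicalType).
Implicit Types (rho : Z -> Z -> R) (tau f : Z -> R).

Definition metrizable := exists d : Z -> Z -> R,
  [/\ forall x y, d x y = 0 <-> x = y,
      forall x y, d x y = d y x,
      forall x y z, d x z <= d x y + d y z &
      forall (x : Z) (A : set Z), nbhs x A <->
        exists2 e : R, 0 < e & [set y | d x y < e] `<=` A].

Definition at_least_four_points :=
  exists x1 x2 x3 x4 : Z, uniq [:: x1; x2; x3; x4].

Definition separating rho :=
  [/\ continuous (fun p : Z * Z => rho p.1 p.2),
      forall x y, 0 <= rho x y,
      forall x y, rho x y = rho y x &
      forall x y, rho x y = 0 <-> x = y].

Definition cross_ratio rho (x x' y y' : Z) : R :=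
  (rho x y * rho x' y') / (rho x y' * rho x' y).

Definition moebius_equiv rho1 rho2 :=
  forall x x' y y' : Z, uniq [:: x; x'; y; y'] ->
    cross_ratio rho1 x x' y y' = cross_ratio rho2 x x' y y'.

Definition antipodal rho :=
  [/\ separating rho,
      sup (range (fun p : Z * Z => rho p.1 p.2)) = 1 &
      forall x, exists y, rho x y = 1].

Definition antipodal_space rho0 :=
  [/\ compact [set: Z], metrizable, at_least_four_points & antipodal rho0].

Definition moebius_space rho0 : set (Z -> Z -> R) :=
  [set rho | antipodal rho /\ moebius_equiv rho rho0].

Definition is_moebius_derivative rho2 rho1 f :=
  [/\ continuous f, forall x, 0 < f x &
      forall x y, rho2 x y ^+ 2 = f x * f y * rho1 x y ^+ 2].

(* The function d rho2 / d rho1; lemma [moebius_derivativeE] shows that the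
   description picks out at most one function. *)
Definition moebius_derivative rho2 rho1 : Z -> R :=
  get (is_moebius_derivative rho2 rho1).

(* Used only on continuous functions on a compact space, where the supremum
   is finite. *)
Definition sup_norm f : R := sup (range (fun x => `|f x|)).

(* Convergence to [g] in C(Z) of a family [u] along the filter [F]. *)
Definition cvg_sup_norm T (F : set_system T) (u : T -> Z -> R) (g : Z -> R) :=
  sup_norm (u t - g) @[t --> F] --> (0 : R).

Definition scaled_function rho1 tau : Z -> Z -> R :=
  fun x y => expR (2^-1 * tau x) * expR (2^-1 * tau y) * rho1 x y.

(* The supremum is a maximum, by lemma [discrepancy_max]. *)
Definition discrepancy rho1 tau : Z -> R := fun x =>
  sup [set tau x + tau y + ln (rho1 x y ^+ 2) | y in [set~ x]].

(* [tau] restricted to [0, +oo[ is a C^1 curve in C(Z), with derivative [dtau]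
   (one-sided at 0).  The values of [tau] at negative times are irrelevant. *)
Definition C1_curve (tau dtau : R -> Z -> R) :=
  forall t, 0 <= t ->
  [/\ continuous (tau t), continuous (dtau t),
      cvg_sup_norm (within [set s | 0 <= s] t^')
        (fun s => (s - t)^-1 *: (tau s - tau t)) (dtau t) &
      cvg_sup_norm (within [set s | 0 <= s] (nbhs t)) dtau (dtau t)].

Definition antipodal_flow rho1 (tau : R -> Z -> R) :=
  exists2 dtau : R -> Z -> R, C1_curve tau dtau &
    forall t, 0 <= t -> dtau t = - discrepancy rho1 (tau t).

Lemma moebius_derivativeE rho2 rho1 f :
  at_least_four_points -> separating rho1 ->
  is_moebius_derivative rho2 rho1 f -> moebius_derivative rho2 rho1 = f.
Proof.
move=> [x1 [x2 [x3 [x4 u]]]] [_ _ _ r0] fD.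
have [_ g0 gE] : is_moebius_derivative rho2 rho1 (moebius_derivative rho2 rho1).
  exact: (getI fD).
have [_ f0 fE] := fD.
move: (moebius_derivative _ _) g0 gE => g g0 gE.
have P x y : x != y -> g x * g y = f x * f y.
  move=> xy; have nz : rho1 x y ^+ 2 != 0.
    by rewrite expf_eq0/=; apply: contra xy => /eqP/r0/eqP.
  by apply: (mulIf nz); rewrite -gE fE.
have H (x : Z) : exists y z, [/\ x != y, x != z & y != z].
  move: u; rewrite /= !inE !negb_or !andbT.
  move=> /and3P[/and3P[x12 x13 x14] /andP[x23 x24] x34].
  have [->|h1] := eqVneq x x1; first by exists x2, x3.
  have [->|h2] := eqVneq x x2; last by exists x1, x2.
  by exists x3, x4.
apply/funext => x; have [y [z [xy xz yz]]] := H x.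
have fyz : f y * f z != 0 by rewrite mulf_neq0 ?gt_eqF.
have sq : g x ^+ 2 = f x ^+ 2.
  apply: (mulIf fyz).
  rewrite -{1}(P _ _ yz) !expr2 mulrACA (P _ _ xy) (P _ _ xz).
  by rewrite mulrACA.
apply/eqP; rewrite -(@eqrXn2 _ 2) ?sq//; exact: ltW.
Qed.

Lemma discrepancy_max rho tau x :
  compact [set: Z] -> at_least_four_points -> separating rho ->
  continuous tau ->
  let F y := tau x + tau y + ln (rho x y ^+ 2) in
  exists y, [/\ y <> x, discrepancy rho tau x = F y &
    forall z, z <> x -> F z <= F y].
Proof.
move=> cZ [x1 [x2 [x3 [x4 u]]]] [rc rge0 _ r0] ctau F.
pose G y := expR (tau x + tau y) * rho x y ^+ 2.
have rxc : continuous (rho x).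
  move=> y; apply: (@continuous_comp _ _ _ (fun y => (x, y))
    (fun p : Z * Z => rho p.1 p.2)); last exact: rc.
  by apply: cvg_pair => //=; exact: cvg_cst.
have Gc : continuous G.
  move=> y; apply: cvgM; last by under eq_fun do rewrite expr2;
    apply: cvgM; exact: rxc.
  apply: (@continuous_comp _ _ _ (fun y => tau x + tau y) expR);
    last exact: continuous_expR.
  by apply: cvgD; [exact: cvg_cst|exact: ctau].
have rgt0 y : y <> x -> 0 < rho x y.
  by move=> yx; rewrite lt_neqAle rge0 andbT eq_sym; apply/eqP => /r0/esym.
have GF y : y <> x -> G y = expR (F y).
  move=> yx; rewrite /F expRD /G lnK// posrE exprn_gt0//; exact: rgt0.
have [w wx] : exists w : Z, w <> x.
  have [e|/eqP] := eqVneq x1 x; last by exists x1.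
  by exists x2; move: u; rewrite /= -e !inE !negb_or => /and4P[/and3P[/eqP + _ _] _ _ _] /esym.
have [||y _ yM] := @compact_EVT_max Z R G setT _ cZ; first by exists x.
  exact: continuous_subspaceT.
have yx : y <> x.
  move=> e; have := yM w (in_setT _); rewrite e /G (r0 x x).2// expr0n/= mulr0.
  by rewrite leNgt mulr_gt0 ?expR_gt0 ?exprn_gt0//; exact: rgt0.
have Fmax z : z <> x -> F z <= F y.
  by move=> zx; rewrite -ler_expR -!GF//; exact: (yM z (in_setT _)).
exists y; split => //; apply/eqP; rewrite eq_le; apply/andP; split.
- apply: ge_sup; first by exists (F y), y.
  by move=> _ [z /= zx <-]; exact: Fmax.
- apply: ub_le_sup; last by exists y.
  by exists (F y) => _ [z /= zx <-]; exact: Fmax.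
Qed.

End AntipodalSpaces.

(* Main.v *)
Require Import Defs.
From HB Require Import structures.
From mathcomp Require Import all_boot all_order all_algebra.
From mathcomp Require Import all_classical all_reals all_analysis.
From mathcomp Require Import ring lra.

Set Implicit Arguments.
Unset Strict Implicit.
Unset Printing Implicit Defensive.

Import Order.TTheory GRing.Theory Num.Theory.
Import numFieldNormedType.Exports.

Local Open Scope classical_set_scope.
Local Open Scope ring_scope.

(** Write d_t = D(tau_t) and F_t(x,y) = tau_t(x) + tau_t(y) + log rho1(x,y)^2, so
that d_t(x) is the maximum of F_t(x,y) over y <> x.  The point of the proof is
that D(tau_t) decays exponentially in the sup norm; the limit and everything
said about it follow from that.

Along the flow, F_t(x,y) has derivative - d_t(x) - d_t(y), and it is at most
both d_t(x) and d_t(y).  Differentiating the maximum d_t(x) itself is avoided by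
freezing y at a point where the maximum is attained at one chosen time.

Upper bound ([max_flow_upper]).  With y maximal at time t, the derivative of
F_s(x,y) is at most -2 F_s(x,y), so exp(2s) F_s(x,y) is nonincreasing on [0,t];
hence exp(2t) d_t(x) <= F_0(x,y) <= d_0(x).

Lower bound ([max_flow_lower]).  Let A bound |d_0|.  The function
m_t(x) = d_t(x) - tau_t(x) = max_y (tau_t(y) + log rho1(x,y)^2) cannot decrease
faster than allowed by the upper bound just found: for s <= t it drops by at
most (A/2)(exp(-2s) - exp(-2t)) ([max_flow_partner]).  Since tau_t(x) solves the
linear equation tau' = - tau - m, this gives exp(t) d_t(x) >= -2A.

Together |d_t| <= 2A exp(-t) ([max_flow_decay]), and integrating,
|tau_t - tau_oo| <= 2A exp(-t) ([max_flow_limit]), which is stronger than the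
rate required.  As D is Lipschitz for the sup norm
([discrepancy_lipschitz]), D(tau_oo) = lim D(tau_t) = 0.  Finally
D(tau_oo) = 0 says that E(tau_oo)(x,y)^2 = exp(F(x,y)) has maximum 1 over y for
each x, so that E(tau_oo) is antipodal ([scaled_function_antipodal]). *)

(** * Functions differentiable on a half-line *)

(** Derivatives are required only at positive times, where they are two-sided;
continuity up to 0 is all that the mean value theorem needs at the endpoint. *)
Definition halfline_derivative (R : realType) (f df : R -> R) :=
  {within `[0, +oo[, continuous f} /\
  forall t : R, 0 < t -> is_derive t (1 : R) f (df t).

Section HalflineDerivative.
Variable R : realType.
Implicit Types f g df dg : R -> R.

Lemma halfline_derivative_le f df (a b : R) :
  halfline_derivative f df -> 0 <= a -> a <= b ->
  (forall t, a <= t <= b -> 0 <= df t) -> f a <= f b.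
Proof.
move=> [cf fD] a0 ab df0.
have [| |c cab E] := @MVT_segment R f df a b ab.
- move=> t; rewrite in_itv/= => /andP[at_ _]; apply: fD.
  exact: le_lt_trans at_.
- apply: continuous_subspaceW cf => t /=; rewrite !in_itv/= andbT.
  by move=> /andP[at_ _]; exact: le_trans at_.
- rewrite -subr_ge0 E mulr_ge0 ?subr_ge0//.
  by apply: df0; move: cab; rewrite in_itv.
Qed.

Lemma halfline_derivativeD f df g dg :
  halfline_derivative f df -> halfline_derivative g dg ->
  halfline_derivative (fun t => f t + g t) (fun t => df t + dg t).
Proof.
move=> [cf fD] [cg gD]; split.
  by move=> t; apply: cvgD; [exact: cf|exact: cg].
by move=> t t0; exact: is_deriveD (fD t t0) (gD t t0).
Qed.

Lemma halfline_derivativeM f df g dg :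
  halfline_derivative f df -> halfline_derivative g dg ->
  halfline_derivative (fun t => f t * g t) (fun t => f t * dg t + g t * df t).
Proof.
move=> [cf fD] [cg gD]; split.
  by move=> t; apply: cvgM; [exact: cf|exact: cg].
by move=> t t0; exact: is_deriveM (fD t t0) (gD t t0).
Qed.

Lemma halfline_derivative_cst (c : R) :
  halfline_derivative (fun=> c) (fun=> 0).
Proof.
split; first by move=> t; exact: cvg_cst.
by move=> t _; exact: is_derive_cst.
Qed.

Lemma halfline_derivative_expR (c : R) :
  halfline_derivative (fun t => expR (c * t)) (fun t => c * expR (c * t)).
Proof.
have D (t : R) : is_derive t (1 : R) (fun t => expR (c * t)) (c * expR (c * t)).
  rewrite mulrC; apply: (@is_derive1_comp _ expR (fun t => c * t)).
  have := @is_deriveZ _ _ _ (id : R -> R) c t 1 1 (is_derive_id _ _).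
  by rewrite /GRing.scale/= mulr1.
split; last by move=> t _; exact: D.
apply: derivable_within_continuous => t _.
exact: (@ex_derive _ _ _ _ _ _ _ (D t)).
Qed.

End HalflineDerivative.

(** * Decay along a flow driven by a maximum *)

(** The antipodal flow with topology removed: [d] is the discrepancy of [u] for
the symmetric kernel [L], which is the logarithm of the squared separating
function. *)
Definition max_flow (R : realType) (Z : Type) (L : Z -> Z -> R)
    (u d : R -> Z -> R) :=
  [/\ forall x, halfline_derivative (u ^~ x) (fun t => - d t x),
      forall x y, L x y = L y x &
      forall t x, 0 <= t -> exists2 y, y <> x &
        d t x = u t x + u t y + L x y /\
        forall z, z <> x -> u t x + u t z + L x z <= d t x].

Section MaxFlow.
Variables (R : realType) (Z : Type) (L : Z -> Z -> R) (u d : R -> Z -> R).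
Hypothesis flow : max_flow L u d.

(** The upper exponential estimate is pointwise: it compares [d t x] with the
initial value at the same [x]. *)
Lemma max_flow_upper t x : 0 <= t -> expR (2 * t) * d t x <= d 0 x.
Proof.
have [uD Lsym dmax] := flow => t0.
(* The partner [y] is optimal at the final time, and a competitor before. *)
have [y yx [dE _]] := dmax t x t0.
have D := halfline_derivativeM (halfline_derivative_cst (-1))
  (halfline_derivativeM (halfline_derivative_expR 2)
  (halfline_derivativeD (halfline_derivativeD (uD x) (uD y))
     (halfline_derivative_cst (L x y)))).
have /= := halfline_derivative_le D (lexx 0) t0.
rewrite mulr0 expR0 -dE => H.
have [_ _ [_ /(_ y yx) F0]] := dmax 0 x (lexx 0).
suff : -1 * (1 * (u 0 x + u 0 y + L x y)) <= -1 * (expR (2 * t) * d t x) by lra.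
apply: H => s /andP[s0 _]; rewrite !mulr0 addr0.
have [_ _ [_ /(_ y yx) Fx]] := dmax s x s0.
have [_ _ [_ /(_ x (nesym yx)) Fy]] := dmax s y s0.
rewrite (Lsym y x) in Fy.
(* The derivative is exp(2s)(d_s(x) + d_s(y) - 2 F_s(x,y)), and F_s(x,y) is at
   most each of d_s(x) and d_s(y). *)
have E0 := expR_gt0 (2 * s).
set e := expR (2 * s) in E0 *; nra.
Qed.

(** The quantity [d t x - u t x] is the maximum of [u t y + L x y] over [y], and
each [u t y] decreases at speed [d t y <= A * expR (- 2 * t)]. *)
Lemma max_flow_partner (A s t : R) x : (forall y, d 0 y <= A) ->
  0 <= s -> s <= t ->
  d s x - u s x <=
  d t x - u t x + A / 2 * (expR (- 2 * s) - expR (- 2 * t)).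
Proof.
have [uD Lsym dmax] := flow => dA s0 st.
have [y yx [dE _]] := dmax s x s0.
have [_ _ [_ /(_ y yx) Ft]] := dmax t x (le_trans s0 st).
have D := halfline_derivativeD (uD y) (halfline_derivativeM
  (halfline_derivative_cst (- (A / 2))) (halfline_derivative_expR (- 2))).
have /= H := halfline_derivative_le D s0 st.
suff : u s y + - (A / 2) * expR (-2 * s) <= u t y + - (A / 2) * expR (-2 * t).
  by rewrite dE; lra.
apply: H => r /andP[sr _].
have := max_flow_upper y (le_trans s0 sr).
have := dA y; set e := expR (-2 * r) => h1 h2.
have e0 : 0 < e := expR_gt0 _.
have ee : e * expR (2 * r) = 1 by rewrite -expRD -mulrDl addNr mul0r expR0.
have : e * (expR (2 * r) * d r y) <= e * A by rewrite ler_pM2l//; lra.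
rewrite mulrA ee; lra.
Qed.

(** Variation of constants for u' = - u - m, where m = d - u is at earlier times
at most its value at time [t] plus an exponentially small term
([max_flow_partner]). *)
Lemma max_flow_lower (A t : R) x : (forall y, `|d 0 y| <= A) -> 0 <= t ->
  - (2 * A) <= expR t * d t x.
Proof.
have [uD _ _] := flow => dA t0.
have A0 : 0 <= A by apply: le_trans (dA x); exact: normr_ge0.
have dA' y : d 0 y <= A by exact: le_trans (ler_norm _) (dA y).
(* By [max_flow_partner], m_s <= k + (A/2) exp(-2s) for s <= t, which makes
   exp(s) (u_s(x) + k) - (A/2) exp(-s) nondecreasing on [0,t]. *)
pose k := d t x - u t x - A / 2 * expR (- 2 * t).
have D := halfline_derivativeD (halfline_derivativeM
   (halfline_derivative_expR 1)
   (halfline_derivativeD (uD x) (halfline_derivative_cst k)))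
   (halfline_derivativeM (halfline_derivative_cst (- (A / 2)))
     (halfline_derivative_expR (- 1))).
have /= H := halfline_derivative_le D (lexx 0) t0.
have P0 := max_flow_partner x dA' (lexx 0) t0.
have d0 : - A <= d 0 x by have := dA x; rewrite ler_norml => /andP[].
have ex2 (s : R) : expR (1 * s) * expR (- 2 * s) = expR (-1 * s).
  by rewrite -expRD; congr expR; ring.
have : expR (1 * 0) * (u 0 x + k) + - (A / 2) * expR (-1 * 0) <=
       expR (1 * t) * (u t x + k) + - (A / 2) * expR (-1 * t).
  apply: H => s /andP[s0 st].
  have := max_flow_partner x dA' s0 st.
  have := expR_gt0 (1 * s); rewrite -ex2 /k.
  set e := expR (1 * s); set e2 := expR (- 2 * s) => e0 h.
  have : 0 <= e * (- d s x + u s x + (d t x - u t x - A / 2 * expR (- 2 * t))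
     + A / 2 * e2) by apply: mulr_ge0; lra.
  lra.
rewrite -(ex2 t) !mulr0 expR0; rewrite mulr0 expR0 in P0; rewrite /k !mul1r.
have := expR_gt0 t; have := expR_gt0 (- 2 * t).
move: (expR (- 2 * t)) (expR t) P0 => e2 e P0 e20 e0.
have : 0 <= A * (e * e2) by rewrite !mulr_ge0// ltW.
lra.
Qed.

Lemma max_flow_decay (A t : R) x : (forall y, `|d 0 y| <= A) -> 0 <= t ->
  `|d t x| <= 2 * A * expR (- t).
Proof.
move=> dA t0.
have A0 : 0 <= A by apply: le_trans (dA x); exact: normr_ge0.
have := max_flow_lower x dA t0; have := max_flow_upper x t0.
have : d 0 x <= A by exact: le_trans (ler_norm _) (dA x).
have -> : expR (2 * t) = expR t * expR t by rewrite -expRD; congr expR; ring.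
have f1 : expR (- t) <= 1 by rewrite -expR0 ler_expR; lra.
have ei : expR t * expR (- t) = 1 by rewrite -expRD subrr expR0.
have := expR_gt0 (- t).
move: (expR (- t)) (expR t) (d t x) f1 ei => f e v f1 ei f0 d0A up low.
have vE : v = f * (e * v) by rewrite mulrA (mulrC f) ei mul1r.
have evE : e * v = f * (e * e * v).
  by rewrite -mulrA [RHS]mulrA (mulrC f) ei mul1r.
have ev2A : e * v <= 2 * A.
  rewrite evE; apply: le_trans (_ : f * A <= _).
    by rewrite ler_pM2l//; exact: le_trans d0A.
  by apply: le_trans (_ : 1 * A <= _); [exact: ler_wpM2r|lra].
rewrite ler_norml vE (mulrC _ f) -mulrN !ler_pM2l// ev2A andbT.
exact: low.
Qed.

(** Since |u'| <= 2A exp(-t), the functions u - 2A exp(-t) and u + 2A exp(-t) are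
respectively nondecreasing and nonincreasing, so they squeeze a limit: the
supremum of the first one. *)
Lemma max_flow_limit (A : R) : (forall y, `|d 0 y| <= A) ->
  exists uoo : Z -> R, forall t x, 0 <= t ->
    `|u t x - uoo x| <= 2 * A * expR (- t).
Proof.
move=> dA; have [uD _ _] := flow.
pose low x t := u t x - 2 * A * expR (- t).
have Ee (s : R) : expR (- 1 * s) = expR (- s) by rewrite mulN1r.
have lowup x s t : 0 <= s -> s <= t -> low x s <= low x t.
  move=> s0 st.
  have D := halfline_derivativeD (uD x) (halfline_derivativeM
    (halfline_derivative_cst (- (2 * A))) (halfline_derivative_expR (- 1))).
  have /= := halfline_derivative_le D s0 st; rewrite !Ee => H.
  suff : u s x + - (2 * A) * expR (- s) <= u t x + - (2 * A) * expR (- t).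
    by rewrite /low !mulNr.
  apply: H => r /andP[sr _]; rewrite Ee.
  have := max_flow_decay x dA (le_trans s0 sr); rewrite ler_norml => /andP[].
  by move: (expR (- r)) (d r x) => e v; lra.
have updown x s t : 0 <= s -> s <= t ->
    u t x + 2 * A * expR (- t) <= u s x + 2 * A * expR (- s).
  move=> s0 st.
  have D := halfline_derivativeM (halfline_derivative_cst (- 1))
    (halfline_derivativeD (uD x) (halfline_derivativeM
    (halfline_derivative_cst (2 * A)) (halfline_derivative_expR (- 1)))).
  have /= := halfline_derivative_le D s0 st; rewrite !Ee => H.
  suff : -1 * (u s x + 2 * A * expR (- s)) <= -1 * (u t x + 2 * A * expR (- t)).
    by rewrite !mulN1r lerN2.
  apply: H => r /andP[sr _]; rewrite Ee.
  have := max_flow_decay x dA (le_trans s0 sr); rewrite ler_norml => /andP[].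
  by move: (expR (- r)) (d r x) => e v; lra.
have lowle x s t : 0 <= s -> 0 <= t -> low x s <= u t x + 2 * A * expR (- t).
  move=> s0 t0.
  have A0 : 0 <= A by apply: le_trans (dA x); exact: normr_ge0.
  have pos r : 0 <= 2 * A * expR (- r) by rewrite !mulr_ge0 ?expR_ge0.
  have [st|/ltW ts] := leP s t.
    by apply: le_trans (lowup x _ _ s0 st) _; rewrite /low; have := pos t; lra.
  by apply: le_trans (updown x _ _ t0 ts); rewrite /low; have := pos s; lra.
pose S x := [set low x s | s in [set s | 0 <= s]].
have Sl x t : 0 <= t -> low x t <= sup (S x).
  move=> t0; apply: ub_le_sup.
    exists (u 0 x + 2 * A * expR (- 0)) => _ [s /= s0 <-].
    exact: lowle.
  by exists t.
have Su x t : 0 <= t -> sup (S x) <= u t x + 2 * A * expR (- t).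
  move=> t0; apply: ge_sup.
    by exists (low x 0), 0 => //=.
  by move=> _ [s /= s0 <-]; exact: lowle.
exists (fun x => sup (S x)) => t x t0; rewrite ler_norml.
by have := Sl x t t0; have := Su x t t0; rewrite /low; lra.
Qed.

End MaxFlow.

(** * The sup norm and curves in C(Z) *)

Section SupNorm.
Variables (R : realType) (Z : topologicalType).
Hypothesis cZ : compact [set: Z].
Implicit Types f g : Z -> R.

Lemma le_sup_norm f x : continuous f -> `|f x| <= sup_norm f.
Proof.
move=> cf; apply: ub_le_sup; last by exists x.
have [||y _ yM] := @compact_EVT_max Z R (fun z => `|f z|) setT _ cZ.
- by exists x.
- by apply: continuous_subspaceT => z; apply: cvg_norm; exact: cf.
by exists `|f y| => _ [z _ <-]; exact: (yM z (in_setT _)).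
Qed.

Lemma sup_norm_le f (B : R) (x0 : Z) : (forall x, `|f x| <= B) -> sup_norm f <= B.
Proof.
move=> fB; apply: ge_sup; first by exists `|f x0|, x0.
by move=> _ [x _ <-].
Qed.

Lemma cvg_sup_norm_pointwise T (F : set_system T) {FF : Filter F}
    (u : T -> Z -> R) g x :
  continuous g -> (\forall t \near F, continuous (u t)) ->
  cvg_sup_norm F u g -> u t x @[t --> F] --> g x.
Proof.
move=> cg cu /cvgr0Pnorm_lt ug.
apply/cvgrPdistC_lt => e e0; near=> t.
have ct : continuous (u t - g).
  have cut : continuous (u t) by near: t.
  by move=> y; apply: cvgB; [exact: cut|exact: cg].
apply: le_lt_trans (le_sup_norm x ct) _.
apply: le_lt_trans (ler_norm _) _.
by near: t; exact: ug.
Unshelve. all: by end_near. Qed.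

(** Evaluation at a point is continuous on C(Z), so it turns a C^1 curve into a
differentiable function; continuity is recovered from the convergence of the
difference quotients. *)
Lemma C1_curve_pointwise (tau dtau : R -> Z -> R) x : C1_curve tau dtau ->
  halfline_derivative (tau ^~ x) (dtau ^~ x).
Proof.
move=> tauC.
have Q t : 0 <= t -> ((s - t)^-1 * (tau s x - tau t x))
    @[s --> within [set s | 0 <= s] t^'] --> dtau t x.
  move=> t0; have [ct cdt q _] := tauC t t0.
  suff cq : \forall s \near within [set s | 0 <= s] t^',
      continuous ((s - t)^-1 *: (tau s - tau t)).
    exact: (cvg_sup_norm_pointwise (x := x) cdt cq q).
  near=> s => y.
  have s0 : 0 <= s by near: s; exact: withinT.
  have [cs _ _ _] := tauC s s0.
  apply: cvgM; first exact: cvg_cst.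
  by apply: cvgB; [exact: cs|exact: ct].
split.
- apply/subspace_continuousP => t /=; rewrite in_itv/= andbT => t0.
  have C : tau s x @[s --> within [set s | 0 <= s] t^'] --> tau t x.
    have st : (s - t) @[s --> within [set s | 0 <= s] t^'] --> (0 : R).
      rewrite -[X in _ --> X](subrr t); apply: cvgB; last exact: cvg_cst.
      by do 2![apply: cvg_within_filter]; exact: cvg_id.
    have C : tau t x + (s - t) * ((s - t)^-1 * (tau s x - tau t x))
        @[s --> within [set s | 0 <= s] t^'] --> tau t x + 0 * dtau t x.
      by apply: cvgD; [exact: cvg_cst|apply: cvgM; [exact: st|exact: Q]].
    rewrite mul0r addr0 in C.
    suff N : {near within [set s | 0 <= s] t^',
        (fun s => tau t x + (s - t) * ((s - t)^-1 * (tau s x - tau t x))) =1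
        tau^~ x}.
      exact: cvg_trans (near_eq_cvg N) C.
    rewrite near_withinE; apply: filterS (nbhs_dnbhs_neq t) => s s_t _.
    by rewrite /= mulVKf ?subr_eq0//; ring.
  apply/cvgrPdist_le => e e0; have /cvgrPdist_le/(_ e e0) H := C.
  have {}H : \forall s \near nbhs t,
    s != t -> 0 <= s -> `|tau t x - tau s x| <= e by exact: H.
  rewrite near_withinE; apply: filterS H => s H; rewrite /= in_itv/= andbT => s0.
  by have [->|/H] := eqVneq s t; [rewrite subrr normr0 ltW|exact].
- move=> t t0.
  have H : h^-1 *: ((tau^~ x \o shift t) (h *: (1 : R)) - tau t x)
      @[h --> 0^'] --> dtau t x.
    apply/cvgrPdist_le => e e0; have /cvgrPdist_le/(_ e e0) H := Q t (ltW t0).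
    have {}H : \forall s \near nbhs t, s != t -> 0 <= s ->
        `|dtau t x - (s - t)^-1 * (tau s x - tau t x)| <= e by exact: H.
    have shift_t : (h + t) @[h --> (0 : R)] --> t.
      by rewrite -[X in _ --> X]add0r; apply: cvgD; [exact: cvg_id|exact: cvg_cst].
    have {}H : \forall h \near nbhs (0 : R), h + t != t -> 0 <= h + t ->
        `|dtau t x - (h + t - t)^-1 * (tau (h + t) x - tau t x)| <= e.
      exact: (shift_t _ H).
    have P : \forall h \near nbhs (0 : R), 0 <= h + t.
      exact: (shift_t _ (lt_le_nbhsr t0)).
    have {}H : \forall h \near nbhs (0 : R), h != 0 ->
        `|dtau t x - h^-1 * (tau (h * 1 + t) x - tau t x)| <= e.
      apply: filterS2 H P => h + ht h0.
      by rewrite addrK mulr1 -subr_eq0 addrK; exact.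
    exact: H.
  apply: DeriveDef; first by apply/cvg_ex; exists (dtau t x).
  exact/cvg_lim.
Unshelve. all: by end_near.
Qed.

Lemma continuous_of_uniform_approx f :
  (forall e : R, 0 < e -> exists2 g, continuous g & forall x, `|g x - f x| <= e) ->
  continuous f.
Proof.
move=> H x; apply/cvgrPdist_le => e e0.
have e3 : 0 < e / 3 by lra.
have [g cg gf] := H _ e3.
near=> y.
have : `|g x - g y| <= e / 3.
  by near: y; move: (cg x) => /cvgrPdist_le; exact.
have := gf x; have := gf y.
by rewrite !ler_norml => /andP[? ?] /andP[? ?] /andP[? ?]; lra.
Unshelve. all: by end_near. Qed.

End SupNorm.

(** * Rescaled separating functions and their discrepancy *)

Section ScaledFunction.
Variables (R : realType) (Z : topologicalType).
Variables (rho : Z -> Z -> R) (tau : Z -> R).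
Hypothesis (srho : separating rho) (ctau : continuous tau).
Notation L x y := (ln (rho x y ^+ 2)).

Lemma scaled_function_separating : separating (scaled_function rho tau).
Proof.
have [rc r_ge0 rsym r0] := srho.
have ce : continuous (fun x => expR (2^-1 * tau x)).
  move=> x; apply: continuous_comp; last exact: continuous_expR.
  by apply: cvgM; [exact: cvg_cst|exact: ctau].
split.
- move=> p; apply: cvgM; last exact: rc.
  apply: cvgM.
  + apply: (@continuous_comp _ _ _ fst (fun x => expR (2^-1 * tau x))).
      exact: cvg_fst.
    exact: ce.
  + apply: (@continuous_comp _ _ _ snd (fun x => expR (2^-1 * tau x))).
      exact: cvg_snd.
    exact: ce.
- by move=> x y; rewrite !mulr_ge0 ?expR_ge0.
- by move=> x y; rewrite /scaled_function rsym; ring.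
- move=> x y; rewrite -r0 /scaled_function; split; last first.
    by move=> ->; rewrite mulr0.
  by move/eqP; rewrite !mulf_eq0 !(gt_eqF (expR_gt0 _))/= => /eqP.
Qed.

Lemma scaled_function_moebius : moebius_equiv (scaled_function rho tau) rho.
Proof.
move=> x x' y y' _; rewrite /cross_ratio /scaled_function.
set a := fun z => expR (2^-1 * tau z).
have a0 z : a z != 0 by rewrite gt_eqF// expR_gt0.
rewrite -!/(a _).
rewrite (_ : a x * a y * rho x y * (a x' * a y' * rho x' y') =
   (a x * a x' * a y * a y') * (rho x y * rho x' y')); last by ring.
rewrite (_ : a x * a y' * rho x y' * (a x' * a y * rho x' y) =
   (a x * a x' * a y * a y') * (rho x y' * rho x' y)); last by ring.
by rewrite -mulf_div divff ?mul1r// !mulf_neq0.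
Qed.

Lemma scaled_function_sqr x y :
  scaled_function rho tau x y ^+ 2 = expR (tau x) * expR (tau y) * rho x y ^+ 2.
Proof.
rewrite /scaled_function !exprMn -!expRM_natl.
by congr (expR _ * expR _ * _); field.
Qed.

Lemma scaled_function_derivative :
  is_moebius_derivative (scaled_function rho tau) rho (expR \o tau).
Proof.
split; last exact: scaled_function_sqr.
- by move=> x; apply: continuous_comp; [exact: ctau|exact: continuous_expR].
- by move=> x; exact: expR_gt0.
Qed.

(** The square of the rescaled function is exp(F), where F is the expression
maximised in the discrepancy; vanishing discrepancy thus means that for each
[x] its maximum over [y] is 1 and is attained. *)
Lemma scaled_function_antipodal :
  compact [set: Z] -> at_least_four_points Z ->
  (forall x, discrepancy rho tau x = 0) -> antipodal (scaled_function rho tau).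
Proof.
move=> cZ fourZ D0.
have srho' := scaled_function_separating.
have [_ r_ge0 _ r0] := srho'; have [_ rho_ge0 _ rho0] := srho.
have sqE x y : y <> x -> scaled_function rho tau x y ^+ 2 =
    expR (tau x + tau y + L x y).
  move=> yx; rewrite scaled_function_sqr !expRD lnK// posrE exprn_gt0//.
  by rewrite lt_neqAle rho_ge0 andbT eq_sym; apply/eqP => /rho0/esym.
have le1 x y : scaled_function rho tau x y <= 1.
  have [->|/eqP yx] := eqVneq y x; first by rewrite (r0 x x).2.
  have [z [_ Dz zmax]] := discrepancy_max x cZ fourZ srho ctau.
  rewrite -(@expr_le1 _ 2)// sqE// -expR0 ler_expR -(D0 x) Dz.
  exact: zmax.
have eq1 x : exists y, scaled_function rho tau x y = 1.
  have [y [yx Dy _]] := discrepancy_max x cZ fourZ srho ctau.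
  exists y; apply/eqP; rewrite -(@eqrXn2 _ 2)//.
  by rewrite sqE// -Dy D0 expR0 expr1n.
split => //.
have [x _] := fourZ; have [y xy1] := eq1 x.
apply/eqP; rewrite eq_le; apply/andP; split.
- apply: ge_sup; first by exists (scaled_function rho tau x y), (x, y).
  by move=> _ [p _ <-]; exact: le1.
- apply: ub_le_sup; last by exists (x, y).
  by exists 1 => _ [p _ <-]; exact: le1.
Qed.

(** Compare the maximisers for [tau] and for [sigma]: each is a competitor in the
other maximum. *)
Lemma discrepancy_lipschitz (sigma : Z -> R) (e : R) x :
  compact [set: Z] -> at_least_four_points Z -> continuous sigma ->
  (forall y, `|tau y - sigma y| <= e) ->
  `|discrepancy rho tau x - discrepancy rho sigma x| <= 2 * e.
Proof.
move=> cZ fourZ csigma close.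
have [y [yx -> ymax]] := discrepancy_max x cZ fourZ srho ctau.
have [z [zx -> zmax]] := discrepancy_max x cZ fourZ srho csigma.
have := zmax y yx; have := ymax z zx.
have := close x; have := close y; have := close z.
rewrite !ler_norml => /andP[? ?] /andP[? ?] /andP[? ?] ? ?; lra.
Qed.

End ScaledFunction.

(** * Convergence of the antipodal flow *)

Section AntipodalFlow.
Variables (R : realType) (Z : topologicalType) (rho : Z -> Z -> R).
Hypotheses (cZ : compact [set: Z]) (fourZ : at_least_four_points Z).
Hypothesis srho : separating rho.
Variable tau : R -> Z -> R.
Hypothesis flow : antipodal_flow rho tau.

Lemma antipodal_flow_continuous t : 0 <= t -> continuous (tau t).
Proof. by move=> t0; have [dtau /(_ t t0)[]] := flow. Qed.

(** The discrepancy is, up to sign, the velocity of a C^1 curve in C(Z). *)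
Lemma discrepancy_continuous t : 0 <= t ->
  continuous (discrepancy rho (tau t)).
Proof.
move=> t0 x; have [dtau /(_ t t0)[_ cd _ _] /(_ t t0) dE] := flow.
rewrite -[discrepancy _ _]opprK -dE; apply: cvgN; exact: cd.
Qed.

Lemma antipodal_flow_max_flow :
  max_flow (fun x y => ln (rho x y ^+ 2)) tau (fun t => discrepancy rho (tau t)).
Proof.
have [_ _ rsym _] := srho.
split.
- move=> x; have [dtau tauC dE] := flow.
  have [cx xD] := C1_curve_pointwise cZ x tauC.
  by split=> // t t0; have := xD t t0; rewrite dE ?ltW.
- by move=> x y; rewrite rsym.
- move=> t x t0.
  have [y [yx Dy ymax]] := discrepancy_max x cZ fourZ srho
    (antipodal_flow_continuous t0).
  by exists y => //; split=> // z /ymax; rewrite Dy.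
Qed.

Lemma antipodal_flow_limit : exists tau_oo : Z -> R, forall t x, 0 <= t ->
  `|tau t x - tau_oo x| <=
  2 * sup_norm (discrepancy rho (tau 0)) * expR (- t).
Proof.
apply: (max_flow_limit antipodal_flow_max_flow) => y.
exact: le_sup_norm (discrepancy_continuous (lexx 0)).
Qed.

Lemma antipodal_flow_discrepancy t x : 0 <= t ->
  `|discrepancy rho (tau t) x| <=
  2 * sup_norm (discrepancy rho (tau 0)) * expR (- t).
Proof.
apply: (max_flow_decay antipodal_flow_max_flow x) => y.
exact: le_sup_norm (discrepancy_continuous (lexx 0)).
Qed.

End AntipodalFlow.

Lemma expRN_small (R : realType) (B e : R) : 0 <= B -> 0 < e ->
  exists2 t : R, 0 <= t & B * expR (- t) <= e.
Proof.
move=> B0 e0; exists (B / e); first by rewrite divr_ge0// ltW.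
have := expR_ge1Dx (B / e); rewrite expRN => h.
have Eg := expR_gt0 (B / e).
by rewrite ler_pdivrMr// -ler_pdivrMl// mulrC; lra.
Qed.

Theorem theorem3p15 (R : realType) (Z : topologicalType)
    (rho0 : Z -> Z -> R) (hZ : antipodal_space rho0)
    (rho1 : Z -> Z -> R) (hrho1 : moebius_space rho0 rho1)
    (tau0 : Z -> R) (htau0 : continuous tau0)
    (tau : R -> Z -> R) (htau : antipodal_flow rho1 tau)
    (tau_start : tau 0 = tau0) :
  exists tau_oo : Z -> R,
    [/\ continuous tau_oo,
        cvg_sup_norm +oo tau tau_oo,
        forall t : R, 0 <= t ->
          sup_norm (tau t - tau_oo) <=
            4 * sup_norm (discrepancy rho1 tau0) * expR (- t / 2),
        forall x : Z, discrepancy rho1 tau_oo x = 0 &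
        let rho := scaled_function rho1 tau_oo in
        [/\ antipodal rho, moebius_equiv rho rho1, moebius_space rho0 rho &
            forall x : Z, ln (moebius_derivative rho rho1 x) = tau_oo x]].
Proof.
have [cZ _ fourZ _] := hZ.
have [[srho1 _ _] mrho1] := hrho1.
have tau_cont := antipodal_flow_continuous htau.
have [tau_oo lim] := antipodal_flow_limit cZ fourZ srho1 htau.
have disc t x := antipodal_flow_discrepancy cZ fourZ srho1 htau (t := t) x.
have [x0 _] := fourZ.
rewrite tau_start in lim disc.
set A := sup_norm (discrepancy rho1 tau0) in lim disc *.
have A0 : 0 <= A.
  have := lim 0 x0 (lexx 0); rewrite oppr0 expR0 mulr1 => h.
  by have := le_trans (normr_ge0 _) h; lra.
have ctau_oo : continuous tau_oo.
  apply: continuous_of_uniform_approx => e e0.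
  have [t t0 te] := @expRN_small R (2 * A) e ltac:(lra) e0.
  exists (tau t); first exact: tau_cont.
  by move=> x; exact: le_trans (lim t x t0) te.
(* |D(tau_oo)(x)| <= |D(tau_oo) - D(tau_t)| + |D(tau_t)|
   <= 2 * 2A exp(-t) + 2A exp(-t), for every t. *)
have D0 x : discrepancy rho1 tau_oo x = 0.
  apply/eqP; rewrite -normr_le0.
  apply/ler_addgt0Pr => e e0; rewrite add0r.
  have [t t0 te] := @expRN_small R (6 * A) e ltac:(lra) e0.
  have close y : `|tau_oo y - tau t y| <= 2 * A * expR (- t).
    by rewrite distrC; exact: lim.
  have := discrepancy_lipschitz srho1 ctau_oo x cZ fourZ (tau_cont t t0) close.
  have := disc t x t0; have := ler_normD (discrepancy rho1 tau_oo x -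
    discrepancy rho1 (tau t) x) (discrepancy rho1 (tau t) x).
  by rewrite subrK; lra.
have bound t : 0 <= t ->
    sup_norm (tau t - tau_oo) <= 4 * A * expR (- t / 2).
  move=> t0; apply: sup_norm_le x0 _ => x; apply: le_trans (lim t x t0) _.
  apply: ler_pM; rewrite ?expR_ge0 ?mulr_ge0 ?ler_wpM2r ?ler_nat//.
  by rewrite ler_expR; lra.
exists tau_oo; split => //.
- apply/cvgr0Pnorm_le => e e0.
  have [T T0 Te] := @expRN_small R (4 * A) e ltac:(lra) e0.
  near=> t.
  have t0 : 0 <= t by near: t; apply: nbhs_pinfty_ge; exact: num_real.
  have tT : T * 2 <= t by near: t; apply: nbhs_pinfty_ge; exact: num_real.
  rewrite ger0_norm.
    apply: le_trans (bound t t0) (le_trans _ Te).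
    by rewrite ler_wpM2l ?ler_expR//; lra.
  apply: le_trans (le_sup_norm cZ x0 _); first exact: normr_ge0.
  by move=> y; apply: cvgB; [exact: tau_cont|exact: ctau_oo].
- move=> rho.
  have arho : antipodal rho by exact: scaled_function_antipodal.
  have mrho : moebius_equiv rho rho1 by exact: scaled_function_moebius.
  split => //.
    by split => // x x' y y' u; rewrite mrho// mrho1.
  move=> x; rewrite (moebius_derivativeE fourZ srho1
    (scaled_function_derivative rho1 ctau_oo)).
  exact: expRK.
Unshelve. all: by end_near. Qed.
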